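(* Let $k\in(-1,1)$ and $N>1$. For every continuous biconvex function $f:\mathbb{R}^2\to\mathbb{R}$, $$ f(1,1)\le\frac{1}{1-k}\int_1^N\bigl(f(kt,t)+f(t,kt)\bigr)\,t^{-\frac{2}{1-k}}\,\frac{dt}{t}+f(N,N)\,N^{-\frac{2}{1-k}} . $$
   Context: A function $f(x,y)$ of two real variables is biconvex if $x\mapsto f(x,y)$ is convex for every $y$ and $y\mapsto f(x,y)$ is convex for every $x$. *)

(* Defs.v *)
From HB Require Import structures.
From mathcomp Require Import all_boot all_order all_algebra.
From mathcomp Require Import all_classical all_reals all_analysis.

Set Implicit Arguments.
Unset Strict Implicit.
Unset Printing Implicit Defensive.

Import Order.TTheory GRing.Theory Num.Theory.
Import numFieldNormedType.Exports.

Local Open Scope classical_set_scope.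
Local Open Scope ring_scope.

Definition biconvex (R : realType) (f : R * R -> R) : Prop :=
  (forall y : R, convex_function ([set: R] : set R) (fun x : R => f (x, y))) /\
  (forall x : R, convex_function ([set: R] : set R) (fun y : R => f (x, y))).

(* Main.v *)
Require Import Defs.
From HB Require Import structures.
From mathcomp Require Import all_boot all_order all_algebra.
From mathcomp Require Import all_classical all_reals all_analysis.
From mathcomp Require Import ring lra.

Set Implicit Arguments.
Unset Strict Implicit.
Unset Printing Implicit Defensive.

Import Order.TTheory GRing.Theory Num.Theory.
Import numFieldNormedType.Exports.

Local Open Scope classical_set_scope.
Local Open Scope ring_scope.

(** Write a = 2 / (1 - k) and consider, for u > 0,

      F u = (1 - k)^-1 * int_1^u (f (k s, s) + f (s, k s)) s^(- a) ds/s
            + f (u, u) u^(- a).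

    The claim is F 1 <= F N, so it suffices that F does not decrease. The
    diagonal term has no derivative in general, but biconvexity controls its
    right difference quotients from below. For t < u close to t, the point
    (t, t) lies on the horizontal segment from (k t, t) to (u, t), and (u, t)
    lies on the vertical segment from (u, k u) to (u, u). Convexity along these
    two segments bounds f (t, t) by a barycentre of f (k t, t), f (u, k u) and
    f (u, u) ([biconvex_diagonal_step]). As u tends to t from the right, the
    weights of the first two points, divided by u - t, both tend to
    1 / ((1 - k) t), which is the rate at which the integral grows, and the
    weight of (u, u) is 1 - a (u - t) / t + o(u - t), which is compensated by
    the variation of u^(- a). Hence (F u - F t) / (u - t) is at least a
    quantity that tends to 0 ([diagonal_right_dini_ge0]), and a continuous
    function with nonnegative lower right Dini derivative is nondecreasing
    ([ge0_right_dini_le]). *)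

(** The conclusion follows from the bounds F a - e (b - a) <= F b for e > 0.
    Given e, the points t with F a - e (t - a) <= F t form a set that contains
    its supremum by continuity, and the Dini condition lets one go further
    right from any of its points other than b. *)
Lemma ge0_right_dini_le (R : realType) (F : R -> R) (a b : R) : a <= b ->
  {in `[a, b], continuous F} ->
  (forall t e, t \in `[a, b[ -> 0 < e ->
     \forall h \near 0^'+, F t - e * h <= F (t + h)) ->
  F a <= F b.
Proof.
move=> ab Fcont dini.
suff slope e : 0 < e -> F a - e * (b - a) <= F b.
  apply/ler_addgt0Pr => e e0.
  (* The 1 in the denominator keeps it positive when a = b. *)
  have d0 : 0 < b - a + 1 by rewrite ltr_wpDl ?subr_ge0.
  have /slope : 0 < e / (b - a + 1) by rewrite divr_gt0.
  rewrite lerBlDr => /le_trans; apply; rewrite lerD2l.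
  rewrite mulrAC ler_pdivrMr// ler_wpM2l ?(ltW e0)// lerDl ler01//.
move=> e0.
pose S := [set t | t \in `[a, b] /\ F a - e * (t - a) <= F t].
have Sa : S a by split; [rewrite in_itv/= lexx|rewrite subrr mulr0 subr0].
have Sb : ubound S b by move=> t [/[!in_itv]/= /andP[]].
have supS : has_sup S by split; [exists a|exists b].
pose s := sup S.
have as_ : a <= s by apply: ub_le_sup => //; exists b.
have sb : s <= b by apply: ge_sup => //; exists a.
have sab : s \in `[a, b] by rewrite in_itv/= as_.
have Ss : S s.
  split=> //; rewrite leNgt; apply/negP => Fs.
  pose G t := F t + e * (t - a).
  have Gcont : {for s, continuous G}.
    apply: cvgD; first exact: Fcont.
    by apply: cvgM; [exact: cvg_cst|apply: cvgB; [exact: cvg_id|exact: cvg_cst]].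
  have : \forall t \near s, G t < F a.
    by apply: (cvgr_lt _ Gcont); rewrite /G -ltrBrDr.
  move=> /nbhs_ballP[d /= d0 sd].
  have [t St st] := sup_adherent d0 supS.
  have ts : t <= s by apply: ub_le_sup => //; exists b.
  have /sd : ball s d t by rewrite /ball/= ger0_norm ?subr_ge0// ltrBlDr addrC -ltrBlDr.
  by rewrite /G -ltrBrDr ltNge St.2.
move: sb; rewrite le_eqVlt => /predU1P[<-|sb]; first exact: Ss.2.
have sab' : s \in `[a, b[ by rewrite in_itv/= as_.
near (0 : R)^'+ => h.
have h0 : 0 < h by near: h; exact: nbhs_right_gt.
have hb : h < b - s by near: h; apply: nbhs_right_lt; rewrite subr_gt0.
have : S (s + h).
  split.
    by rewrite in_itv/=; apply/andP; split; lra.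
  have Fh : F s - e * h <= F (s + h) by near: h; exact: dini.
  apply: le_trans Fh; have := Ss.2; lra.
move=> /(ub_le_sup (ex_intro _ b Sb)).
by rewrite -/s gerDl leNgt h0.
Unshelve. all: by end_near. Qed.

Lemma convex_function_le (R : realType) (g : R -> R) (x y z l m : R) :
  convex_function ([set: R] : set R) g ->
  0 <= l -> 0 <= m -> l + m = 1 -> z = l * x + m * y ->
  g z <= l * g x + m * g y.
Proof.
move=> cg l0 m0 lm ->.
have l1 : l <= 1 by rewrite -lm lerDl.
have h : 0 <= l <= 1 by apply/andP.
have mE : m = 1 - l by rewrite -lm addrAC subrr add0r.
by have := cg (Itv01 l0 l1) x y; rewrite mE; apply; rewrite inE.
Qed.

(** The weights are the products of those of (t, t) between (k t, t) and (u, t)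
    and those of (u, t) between (u, k u) and (u, u); the condition k u <= t
    says that t lies between k u and u. *)
Lemma biconvex_diagonal_step (R : realType) (f : R * R -> R) (k t u : R) :
  biconvex f -> k < 1 -> 0 < t -> t < u -> k * u <= t ->
  f (t, t) <= (u - t) / (u - k * t) * f (k * t, t) +
    t * (u - t) / (u * (u - k * t)) * f (u, k * u) +
    t * (t - k * u) / (u * (u - k * t)) * f (u, u).
Proof.
move=> [fx fy] k1 t0 tu kut.
have u0 : 0 < u by exact: lt_trans tu.
have ukt : 0 < u - k * t.
  by rewrite subr_gt0 (le_lt_trans _ tu)// ler_piMl ?ltW.
have k10 : 0 < 1 - k by rewrite subr_gt0.
have [t_ge0 u_ge0 ukt_ge0 k_ge0] := And4 (ltW t0) (ltW u0) (ltW ukt) (ltW k10).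
have ut_ge0 : 0 <= u - t by rewrite subr_ge0 ltW.
have tku_ge0 : 0 <= t - k * u by rewrite subr_ge0.
have ? : u - k * t != 0 by rewrite gt_eqF.
have ? : u != 0 by rewrite gt_eqF.
have ? : 1 - k != 0 by rewrite gt_eqF.
have horizontal : f (t, t) <=
    (u - t) / (u - k * t) * f (k * t, t) + t * (1 - k) / (u - k * t) * f (u, t).
  apply: (convex_function_le (fx t)).
  - by rewrite divr_ge0.
  - by rewrite divr_ge0 ?mulr_ge0.
  - by field.
  - by field.
have vertical : f (u, t) <=
    (u - t) / (u * (1 - k)) * f (u, k * u) + (t - k * u) / (u * (1 - k)) * f (u, u).
  apply: (convex_function_le (fy u)).
  - by rewrite divr_ge0 ?mulr_ge0.
  - by rewrite divr_ge0 ?mulr_ge0.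
  - by field; apply/andP.
  - by field; apply/andP.
apply: (le_trans horizontal); rewrite -addrA lerD2l.
have w0 : 0 <= t * (1 - k) / (u - k * t) by rewrite divr_ge0 ?mulr_ge0.
apply: le_trans (ler_wpM2l w0 vertical) _.
rewrite le_eqVlt; apply/orP; left; apply/eqP.
by field; apply/and3P.
Qed.

Lemma dnbhs_at_right (R : realType) (x : R) : x^'+ `=>` x^'.
Proof.
move=> A; apply: (@filterS _ (nbhs x)) => y + xy.
by apply; rewrite gt_eqF.
Qed.

Lemma is_derive_cvg_right (R : realType) (g : R -> R) (t d : R) :
  is_derive t 1 g d -> (g (t + h) - g t) / h @[h --> 0^'+] --> d.
Proof.
move=> [gd <-]; have := cvg_trans (cvg_app _ (dnbhs_at_right (x := 0))) gd.
apply: cvg_trans; apply: near_eq_cvg; near=> h.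
by rewrite /= [h%:A]mulr1 [h + t]addrC; exact: mulrC.
Unshelve. all: by end_near. Qed.

Lemma cvg_comp_pair (R : realType) (T : Type) (F : set_system T)
    (FF : Filter F) (f : R * R -> R) (x y : T -> R) (l m : R) :
  continuous f -> x z @[z --> F] --> l -> y z @[z --> F] --> m ->
  f (x z, y z) @[z --> F] --> f (l, m).
Proof.
move=> fcont xl ym.
exact: (@cvg_comp _ _ _ (fun z => (x z, y z)) f _ _ _ (cvg_pair xl ym) (fcont (l, m))).
Qed.

(** Only the derivative of J at t matters, so J stands for the integral with any
    base point. *)
Lemma diagonal_right_dini_ge0 (R : realType) (f : R * R -> R) (J : R -> R)
    (k t e : R) : let a := 2 / (1 - k) in
  let F u := (1 - k)^-1 * J u + f (u, u) * u `^ (- a) in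
  continuous f -> biconvex f -> k < 1 -> 0 < t ->
  is_derive t 1 J ((f (k * t, t) + f (t, k * t)) * t `^ (- a) / t) ->
  0 < e ->
  \forall h \near 0^'+, F t - e * h <= F (t + h).
Proof.
move=> a F fcont fconv k1 t0 dJ e0.
have k10 : 0 < 1 - k by rewrite subr_gt0.
have dJ_cvg := is_derive_cvg_right dJ.
have dpow_cvg := is_derive_cvg_right (is_derive1_powR (- a) t0).
have shift : t + h @[h --> 0^'+] --> t.
  rewrite -[X in _ --> X]addr0; apply: cvgD; first exact: cvg_cst.
  exact/cvg_at_right_filter/cvg_id.
pose q u := u - k * t.
have q0 : q t != 0.
  by rewrite /q -{1}[t]mul1r -mulrBl mulf_neq0 ?gt_eqF.
have qcvg : q (t + h) @[h --> 0^'+] --> q t.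
  by apply: cvgB; [exact: shift|exact: cvg_cst].
have t_neq0 : t != 0 by rewrite gt_eqF.
(* [E h] is the lower bound for (F (t + h) - F t) / h obtained by replacing
   f (t, t) with its barycentric bound. The part that does not contain J or a
   power quotient comes from the identity
   1 - t (t - k u) / (u q u) = (u - t) (u + t) / (u q u) at u = t + h. *)
pose E h := f (t + h, t + h) * (((t + h) `^ (- a) - t `^ (- a)) / h +
      t `^ (- a) * ((t + h + t) / ((t + h) * q (t + h)))) -
    t `^ (- a) / q (t + h) *
      (f (k * t, t) + t / (t + h) * f (t + h, k * (t + h))) +
    (1 - k)^-1 * ((J (t + h) - J t) / h).
have E0 : E h @[h --> 0^'+] --> 0.
  pose L := f (t, t) * (- a * t `^ (- a - 1) +
      t `^ (- a) * ((t + t) / (t * q t))) -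
    t `^ (- a) / q t * (f (k * t, t) + t / t * f (t, k * t)) +
    (1 - k)^-1 * ((f (k * t, t) + f (t, k * t)) * t `^ (- a) / t).
  suff EL : E h @[h --> 0^'+] --> L.
    suff L0 : L = 0 by rewrite L0 in EL.
    rewrite /L powRD; last by rewrite t_neq0 implybT.
    rewrite powR_inv1 ?ltW// /a /q; field.
    by rewrite t_neq0 q0 gt_eqF.
  apply: cvgD; last first.
    by apply: cvgM; [exact: cvg_cst|exact: dJ_cvg].
  apply: cvgB; apply: cvgM.
  - exact: cvg_comp_pair.
  - apply: cvgD; first exact: dpow_cvg.
    apply: cvgM; first exact: cvg_cst.
    apply: cvgM; first by apply: cvgD => //; exact: cvg_cst.
    by apply: cvgV; [rewrite mulf_neq0|exact: cvgM].
  - by apply: cvgM; [exact: cvg_cst|exact: cvgV].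
  - apply: cvgD; first exact: cvg_cst.
    apply: cvgM; first by apply: cvgM; [exact: cvg_cst|exact: cvgV].
    by apply: cvg_comp_pair => //; apply: cvgM => //; exact: cvg_cst.
have Ee : \forall h \near 0^'+, - e < E h.
  by apply: (cvgr_gt _ E0); rewrite oppr_lt0.
have kut : \forall h \near 0^'+, k * (t + h) < t.
  apply: (cvgr_lt (k * t)); last by rewrite gtr_pMl.
  by apply: cvgM => //; exact: cvg_cst.
near=> h.
have h0 : 0 < h by near: h; exact: nbhs_right_gt.
have th : t < t + h by rewrite ltrDl.
have kth : k * (t + h) <= t by apply: ltW; near: h.
have Eh : - e < E h by near: h.
have th_neq0 : t + h != 0 by rewrite gt_eqF// addr_gt0.
have qth_neq0 : t + h - k * t != 0.
  by rewrite gt_eqF// addrAC addr_gt0// subr_gt0 gtr_pMl.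
have step := biconvex_diagonal_step fconv k1 t0 th kth.
set B := (X in _ <= X) in step.
have hE : h * E h = F (t + h) - F t + t `^ (- a) * (f (t, t) - B).
  rewrite /E /F /B /q; field.
  by rewrite th_neq0 qth_neq0 !gt_eqF.
have : - e * h < h * E h by rewrite mulrC ltr_pM2l.
have : t `^ (- a) * (f (t, t) - B) <= 0.
  by rewrite mulr_ge0_le0 ?powR_ge0// subr_le0.
rewrite hE; lra.
Unshelve. all: by end_near. Qed.

Lemma is_derive1_continuous (R : realType) (g : R -> R) (t d : R) :
  is_derive t 1 g d -> {for t, continuous g}.
Proof.
by move=> [gd _]; apply: differentiable_continuous; exact/derivable1_diffP.
Qed.

Theorem lemma9 (R : realType) (k N : R) (hk : -1 < k < 1) (hN : 1 < N)
  (f : R * R -> R) (fcont : continuous f) (fconv : biconvex f) :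
  f (1, 1) <=
    (1 - k)^-1 *
      (\int[lebesgue_measure]_(t in `[1, N])
         ((f (k * t, t) + f (t, k * t)) * t `^ (- (2 / (1 - k))) / t))
    + f (N, N) * N `^ (- (2 / (1 - k))).
Proof.
have /andP[_ k1] := hk.
set a := 2 / (1 - k).
pose G t := (f (k * t, t) + f (t, k * t)) * t `^ (- a) / t.
have powcont (t : R) : 0 < t -> u `^ (- a) @[u --> t] --> t `^ (- a).
  by move=> t0; apply: is_derive1_continuous (is_derive1_powR (- a) t0).
have kcont (t : R) : k * u @[u --> t] --> k * t.
  by apply: cvgM; [exact: cvg_cst|exact: cvg_id].
have Gcont (t : R) : 0 < t -> G u @[u --> t] --> G t.
  move=> t0; rewrite /G; apply: cvgM.
    apply: cvgM; last exact: powcont.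
    by apply: cvgD; apply: cvg_comp_pair => //; do ?[exact: kcont|exact: cvg_id].
  by apply: cvgV; [rewrite gt_eqF|exact: cvg_id].
(* The integral starts at 1 / 2 so that 1 is interior to the interval, which
   makes it differentiable at 1, while staying away from 0, where the integrand
   is singular. *)
have Gint (u : R) : lebesgue_measure.-integrable `[1 / 2, u] (EFin \o G).
  apply: continuous_compact_integrable; first exact: segment_compact.
  apply: continuous_in_subspaceT => t /[!inE]/= /[!in_itv]/= /andP[t2 _].
  by apply: Gcont; lra.
pose J (u : R) := (\int[lebesgue_measure]_(t in `[1 / 2, u]) G t)%R.
have dJ (t : R) : 1 / 2 < t -> is_derive t 1 J (G t).
  move=> t2.
  have t0 : 0 < t by lra.
  have tt : t < t + 1 by lra.
  have [dJ JG] := continuous_FTC1_closed tt (Gint _) t2 (Gcont t t0).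
  by split => //; rewrite -derive1E.
pose F u := (1 - k)^-1 * J u + f (u, u) * u `^ (- a).
have F1N : F 1 <= F N.
  apply: ge0_right_dini_le; first exact: ltW.
    move=> t; rewrite in_itv/= => /andP[t1 _].
    rewrite /prop_for /continuous_at /F.
    apply: cvgD; apply: cvgM.
    - exact: cvg_cst.
    - by apply: is_derive1_continuous (dJ t _); lra.
    - exact: cvg_comp_pair.
    - by apply: powcont; lra.
  move=> t e; rewrite in_itv/= => /andP[t1 _] e0.
  by apply: diagonal_right_dini_ge0 => //; [lra|apply: dJ; lra].
have -> : \int[lebesgue_measure]_(t in `[1, N]) G t = J N - J 1.
  rewrite Rintegral_itvB ?bnd_simp ?ltW//; last lra.
  rewrite Rintegral_itv_obnd_cbnd//; apply: integrableS (Gint N) => //.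
  by apply: subset_itv; rewrite bnd_simp; lra.
by move: F1N; rewrite /F powR1 mulr1; lra.
Qed.
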